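(* $A_2(10,6;4)\ge 4173$.
   Context: For a prime power $q$, $\mathbb{F}_q$ is the finite field with $q$ elements, and $\mathcal{G}_q(n,k)$ is the set of all $k$-dimensional subspaces of $\mathbb{F}_q^n$. The subspace distance of two subspaces $U,W\subseteq\mathbb{F}_q^n$ is $d_S(U,W)=\dim U+\dim W-2\dim(U\cap W)$. $A_q(n,d;k)$ denotes the maximum size of a set $\mathcal{C}\subseteq\mathcal{G}_q(n,k)$ such that $d_S(U,W)\ge d$ for all distinct $U,W\in\mathcal{C}$. *)

(* Defs.v *)
From HB Require Import structures.
From mathcomp Require Import all_boot all_order all_algebra all_field.

Set Implicit Arguments.
Unset Strict Implicit.
Unset Printing Implicit Defensive.

Import GRing.Theory.

(* A subspace is stored as a canonical matrix (exposed as a subtype only in    *)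
(* VectorInternalTheory), so over a finite field the subspaces form a finType. *)
Import VectorInternalTheory.

HB.instance Definition _ (F : finFieldType) (vT : vectType F) :=
  [Countable of {vspace vT} by <:].
HB.instance Definition _ (F : finFieldType) (vT : vectType F) :=
  [Finite of {vspace vT} by <:].

(* In what follows, F plays the role of the field with q elements. *)

Definition grassmannian (F : finFieldType) (n k : nat) :
    {set {vspace 'rV[F]_n}} :=
  [set U | \dim U == k].

(* The subtraction is on nat; by subspace_dist_no_trunc it never truncates. *)
Definition subspace_dist (F : finFieldType) (n : nat)
    (U W : {vspace 'rV[F]_n}) : nat :=
  \dim U + \dim W - 2 * \dim (U :&: W)%VS.

Lemma subspace_dist_no_trunc (F : finFieldType) (n : nat)
    (U W : {vspace 'rV[F]_n}) :
  2 * \dim (U :&: W)%VS <= \dim U + \dim W.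
Proof. by rewrite mul2n -addnn leq_add // dimvS ?capvSl ?capvSr. Qed.

Definition min_dist_ge (F : finFieldType) (n d : nat)
    (C : {set {vspace 'rV[F]_n}}) : bool :=
  [forall U in C, forall W in C, (U != W) ==> (d <= subspace_dist U W)].

Definition A (F : finFieldType) (n d k : nat) : nat :=
  \max_(C : {set {vspace 'rV[F]_n}} |
          (C \subset grassmannian F n k) && min_dist_ge d C) #|C|.

(* Main.v *)
From HB Require Import structures.
Require Import Defs.
From Stdlib Require Import NArith Lia.
From mathcomp Require Import all_boot all_order all_algebra all_field.
From mathcomp Require Import ring.

Set Implicit Arguments.
Unset Strict Implicit.
Unset Printing Implicit Defensive.

Import GRing.Theory passmx.
Local Open Scope ring_scope.

(** The code consists of 4096 + 77 subspaces of F_2^10 of dimension 4.  For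
    dimension 4, distance at least 6 means that two codewords share at most
    one nonzero vector, so only dimensions of intersections are studied.

    Split F_2^10 as F_2^4 x S with S = F_2^6, and identify S with the field L
    of 64 elements.  The first 4096 codewords form a lifted Gabidulin code: they
    are the graphs of the maps x |-> a x + b x^2 from a 4-dimensional subspace
    of L to L, for a and b in L.  Two of these maps differ by a map of the
    same form with (a, b) <> 0, which has at most one nonzero root; so two
    graphs share at most one nonzero vector (lifted_gabidulin_meet).

    Any 4-dimensional U whose projection to F_2^4 is at most one-dimensional,
    say contained in {0, p}, can be added: the projection is injective on a
    graph, so a graph and U share at most one nonzero vector
    (lifted_gabidulin_bit_space_meet).  If p <> 0 is attained, such a U is
    spanned by a 3-dimensional subspace E of S and a vector (p, v), where only
    v modulo E matters.  Two of these, given by (E, p, v) and (E', p', v'), meet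
    in dimension at most one exactly when dim (E :&: E') <= 1 and one of the
    following holds: p <> p', so that they meet inside S; E :&: E' = 0, so that
    they share no vector of S except 0; or v - v' is not in E + E', so that
    again they meet inside S.

    In F_2^6 there are 77 subspaces of dimension 3 that pairwise meet in
    dimension at most one, the largest possible number.  The list
    extended_planes consists of 77 such E, each with a choice of one of the 15
    nonzero points p and of an offset v, for which the conditions above hold
    (extended_planes_ok, extended_planes_meet). *)

(** * Codes from families of subspaces *)

(** A positive distance between distinct members also makes the family
    injective, so its index type counts the codewords. *)
Lemma leq_A_of_family (F : finFieldType) (n d k : nat) (I : finType)
    (U : I -> {vspace 'rV[F]_n}) :
    (0 < d)%N -> (forall i, \dim (U i) = k) ->
    (forall i j, i != j -> (d <= subspace_dist (U i) (U j))%N) ->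
  (#|I| <= A F n d k)%N.
Proof.
move=> d_gt0 dimU distU.
have U_inj : injective U.
  move=> i j eqU; apply/eqP; apply: contraTT d_gt0 => /distU.
  rewrite eqU /subspace_dist capvv mul2n -addnn subnn leqn0 => /eqP->.
  by rewrite ltnn.
rewrite -cardsT -(card_imset _ U_inj) /A.
apply: (@leq_bigmax_cond _ _ (fun C : {set {vspace 'rV[F]_n}} => #|C|)).
apply/andP; split.
  by apply/subsetP=> _ /imsetP[i _ ->]; rewrite inE dimU.
apply/forall_inP=> _ /imsetP[i _ ->]; apply/forall_inP=> _ /imsetP[j _ ->].
by apply/implyP=> neqU; apply: distU; apply: contraNneq neqU => ->.
Qed.

(** Over F_2 the hypothesis says exactly that the dimension is at most one.
    All the bounds on intersections below are obtained from this. *)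
Lemma dim_le1 (K : fieldType) (vT : vectType K) (V : {vspace vT}) :
  (forall x y, x \in V -> y \in V -> x != 0 -> y != 0 -> x = y) ->
  (\dim V <= 1)%N.
Proof.
move=> eqV; suff /dimvS : (V <= <[vpick V]>)%VS.
  by move/leq_trans; apply; rewrite dim_vline leq_b1.
apply/subvP=> x Vx; have [->|x0] := eqVneq x 0; first exact: mem0v.
rewrite (eqV x (vpick V)) ?memv_pick ?memv_line // vpick0.
by apply: contraNneq x0 => V0; rewrite V0 memv0 in Vx.
Qed.

Lemma F2_cases (a : 'F_2) : a = 0 \/ a = 1.
Proof.
by case: a => [[|[|m]] //= lt_m]; [left | right]; apply: val_inj.
Qed.

(** * The lifted Gabidulin code *)

Section LiftedGabidulin.

Variables (k r : nat) (L : fieldExtType 'F_2).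
(** Coordinates identifying the second summand of F_2^k x F_2^(k + r) with the
    field L; the polynomials below are evaluated in L. *)
Variable g : {linear 'rV['F_2]_(k + r) -> L}.
Variable g' : {linear L -> 'rV['F_2]_(k + r)}.
Hypotheses (gK : cancel g g') (g'K : cancel g' g).

(* The k-dimensional subspace of L on which the polynomials are evaluated. *)
Let h (x : 'rV['F_2]_k) : L := g (row_mx x 0).

(** The graph of the linearized binomial a X + b X ^ 2, where c holds the
    coordinates of a and b. *)
Definition gabidulin_row (c : 'rV['F_2]_(k + r) * 'rV['F_2]_(k + r)) x :
    'rV['F_2]_(k + (k + r)) :=
  row_mx x (g' (g c.1 * h x + g c.2 * h x ^+ 2)).

(** Squaring is additive in characteristic 2, and the scalars 0 and 1 are equal
    to their squares. *)
Fact gabidulin_row_linear c : linear (gabidulin_row c).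
Proof.
move=> a x y; rewrite /gabidulin_row.
have hD : h (a *: x + y) = a *: h x + h y.
  by rewrite /h -linearP scale_row_mx add_row_mx scaler0 addr0.
have sq2 : (a *: h x + h y) ^+ 2 = a *: h x ^+ 2 + h y ^+ 2.
  have pchar2 : 2%N \in [pchar L] by rewrite pchar_lalg pchar_Fp.
  rewrite -!(pFrobenius_autE pchar2) pFrobenius_autD_comm; last exact: mulrC.
  rewrite !pFrobenius_autE exprZn.
  by case: (F2_cases a) => ->; rewrite ?expr0n ?expr1n.
rewrite hD sq2 scale_row_mx add_row_mx -(linearP g'); congr (row_mx _ (g' _)).
by rewrite !mulrDr scalerDr -!scalerAr addrACA.
Qed.

HB.instance Definition _ c :=
  GRing.isSemilinear.Build 'F_2 _ _ _ (gabidulin_row c)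
    (GRing.semilinear_linear (gabidulin_row_linear c)).

Definition lifted_gabidulin c := limg (linfun (gabidulin_row c)).

(** The projection to the first summand is injective on a codeword. *)
Lemma memv_lifted_gabidulin c u :
  u \in lifted_gabidulin c -> u = gabidulin_row c (lsubmx u).
Proof. by case/memv_imgP=> x _ ->; rewrite lfunE /= row_mxKl. Qed.

Lemma dim_lifted_gabidulin c : \dim (lifted_gabidulin c) = k.
Proof.
rewrite limg_dim_eq; first by rewrite dimvf /dim /= mul1n.
rewrite capfv; apply/eqP/lker0P=> x y; rewrite !lfunE /=.
by case/eq_row_mx.
Qed.

(** With k-by-(k + r) matrices for the maps, this is the rank distance k - 1 of
    the Gabidulin code. *)
Lemma lifted_gabidulin_meet c d :
  c != d -> (\dim (lifted_gabidulin c :&: lifted_gabidulin d) <= 1)%N.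
Proof.
move=> neq_cd; apply: dim_le1 => u v.
rewrite !memv_cap => /andP[uc ud] /andP[vc vd] u0 v0.
(* A common vector projects to a nonzero root x of the difference of the two
   binomials; after division by x, the equation on x is linear. *)
have root_of w : w \in lifted_gabidulin c -> w \in lifted_gabidulin d ->
    w != 0 -> h (lsubmx w) * (g c.2 - g d.2) = - (g c.1 - g d.1).
  move=> /memv_lifted_gabidulin wc /memv_lifted_gabidulin wd w0.
  have hw0 : h (lsubmx w) != 0.
    apply: contraNneq w0 => hw0.
    have: row_mx (lsubmx w) 0 = 0 :> 'rV_(k + r).
      by apply: (can_inj gK); rewrite linear0.
    rewrite -row_mx0 => /eq_row_mx[w10 _].
    rewrite wc /gabidulin_row hw0 w10 expr0n !mulr0 addr0 linear0.
    by rewrite row_mx0.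
  move: wd; rewrite {1}wc => /eq_row_mx[_ /(can_inj g'K) /eqP].
  rewrite -subr_eq0 => /eqP eq0; apply/eqP; rewrite -addr_eq0; apply/eqP.
  apply: (mulfI hw0); rewrite mulr0 -eq0 !mulrDr !mulrN expr2.
  ring.
have [eq2|neq2] := eqVneq c.2 d.2.
  have := root_of u uc ud u0; rewrite eq2 subrr mulr0 => /eqP.
  rewrite eq_sym oppr_eq0 subr_eq0 => /eqP/(can_inj gK) eq1.
  case/eqP: neq_cd; case: c d eq1 eq2 {uc ud vc vd root_of} => c1 c2 [d1 d2].
  by move=> /= -> ->.
have nz : g c.2 - g d.2 != 0 by rewrite subr_eq0 (can_eq gK).
have : h (lsubmx u) = h (lsubmx v).
  by apply: (mulIf nz); rewrite !root_of.
move/(can_inj gK)/eq_row_mx=> [eq_uv _].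
by rewrite (memv_lifted_gabidulin uc) eq_uv -memv_lifted_gabidulin.
Qed.

End LiftedGabidulin.

(** * Subspaces given by binary codes of their vectors *)

Definition bits n (a : N) : 'rV['F_2]_n :=
  \row_i (N.testbit a (N.of_nat i))%:R.

(** Only the n lowest bits of a number count in bits n; this is the normal form
    of a code for that purpose. *)
Definition low n (a : N) : N := N.land a (N.ones (N.of_nat n)).

Lemma bits0 n : bits n 0%num = 0.
Proof. by apply/rowP=> i; rewrite !mxE N.bits_0. Qed.

Lemma bitsD n a b : bits n (N.lxor a b) = bits n a + bits n b.
Proof.
apply/rowP=> i; rewrite !mxE N.lxor_spec.
by case: (N.testbit a _) (N.testbit b _) => -[] //=; apply: val_inj.
Qed.

Lemma bits_low n a : bits n (low n a) = bits n a.
Proof.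
apply/rowP=> i; rewrite !mxE N.land_spec N.ones_spec_low ?andbT //.
by move/ltP: (ltn_ord i); lia.
Qed.

Lemma low_inj n a b : bits n a = bits n b -> low n a = low n b.
Proof.
move=> /rowP eq_ab; apply: N.bits_inj => i; rewrite !N.land_spec.
have [lt_in|le_ni] := N.lt_ge_cases i (N.of_nat n); last first.
  by rewrite N.ones_spec_high // !andbF.
have lt_in' : (N.to_nat i < n)%N by apply/ltP; lia.
have := eq_ab (Ordinal lt_in'); rewrite !mxE /= Nnat.N2Nat.id.
by do 2!case: (N.testbit _ i).
Qed.

Lemma lsubmx_bits m n a : lsubmx (bits (m + n) a) = bits m a.
Proof. by apply/rowP=> i; rewrite !mxE. Qed.

Fixpoint xor_span (s : seq N) : seq N :=
  if s is a :: s' then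
    let t := xor_span s' in t ++ map (N.lxor a) t
  else [:: 0%num].

Definition words n (s : seq N) : seq N := map (low n) (xor_span s).

Definition bit_space n (s : seq N) : {vspace 'rV['F_2]_n} :=
  <<map (bits n) s>>%VS.

(** This turns a statement about all vectors of the space into one about a
    list of 2 ^ size s numbers, which can be checked by computation. *)
Lemma memv_bit_space n s v :
  v \in bit_space n s -> exists2 a, a \in words n s & v = bits n a.
Proof.
suff span_v : v \in bit_space n s ->
    exists2 a, a \in xor_span s & v = bits n a.
  by case/span_v=> a sa ->; exists (low n a); rewrite ?map_f ?bits_low.
rewrite /bit_space; elim: s v => [|b s IHs] v /=.
  rewrite span_nil memv0 => /eqP->; exists 0%num; first exact: mem_head.
  by rewrite bits0.
rewrite span_cons => /memv_addP[_ /vlineP[c ->] [w /IHs[a sa ->] ->]].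
have [->|->] := F2_cases c.
  by exists a; rewrite ?scale0r ?add0r // mem_cat sa.
by exists (N.lxor b a); rewrite ?scale1r ?bitsD // mem_cat map_f ?orbT.
Qed.

Lemma low_words n s a : a \in words n s -> low n a = a.
Proof. by case/mapP=> b _ ->; rewrite /low -N.land_assoc N.land_diag. Qed.

Fixpoint xor_free n (s : seq N) : bool :=
  if s is a :: s' then ~~ has (N.eqb (low n a)) (words n s') && xor_free n s'
  else true.

Lemma dim_bit_space n s : xor_free n s -> \dim (bit_space n s) = size s.
Proof.
rewrite -(size_map (bits n)) => free_s; apply/eqP.
change (free (map (bits n) s)).
elim: s free_s => [_|a s IHs /= /andP[notin /IHs free_s]].
  exact: nil_free.
rewrite free_cons free_s andbT.
apply: contra notin => /memv_bit_space[b sb eq_ab].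
by apply/hasP; exists b; rewrite // -(low_words sb) (low_inj eq_ab) N.eqb_refl.
Qed.

(** Equal numbers are equal vectors only for normalized codes, so the lists are
    meant to be values of words. *)
Definition share_le1 (t u : seq N) :=
  (size [seq a <- t | ~~ N.eqb a 0 & has (N.eqb a) u] <= 1)%N.

Lemma bit_space_meet n s t :
  share_le1 (words n s) (words n t) ->
  (\dim (bit_space n s :&: bit_space n t) <= 1)%N.
Proof.
rewrite /share_le1; set f := filter _ _ => size_f.
have sub_f v : v \in (bit_space n s :&: bit_space n t)%VS -> v != 0 ->
    exists2 a, a \in f & v = bits n a.
  rewrite memv_cap => /andP[/memv_bit_space[a sa ->] /memv_bit_space[b tb]].
  move/low_inj; rewrite (low_words sa) (low_words tb) => eq_ab a0.
  exists a => //; rewrite mem_filter sa andbT; apply/andP; split.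
    by apply: contraNN a0 => /N.eqb_spec->; rewrite bits0.
  by apply/hasP; exists b; rewrite // eq_ab N.eqb_refl.
apply: dim_le1 => u v Wu Wv /(sub_f u Wu)[a fa ->] /(sub_f v Wv)[b fb ->].
by case: f size_f fa fb {sub_f} => [|c []] //= _; rewrite !inE => /eqP-> /eqP->.
Qed.

(** The vectors of the space project to 0 or to a single vector p, and a vector
    of the graph is determined by its projection. *)
Lemma lifted_gabidulin_bit_space_meet k r (L : fieldExtType 'F_2)
    (g : {linear 'rV['F_2]_(k + r) -> L}) (g' : {linear L -> 'rV['F_2]_(k + r)})
    c s p :
  all (fun a => N.eqb (low k a) 0 || N.eqb (low k a) p)
      (words (k + (k + r)) s) ->
  (\dim (lifted_gabidulin g g' c :&: bit_space (k + (k + r)) s) <= 1)%N.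
Proof.
move=> /allP low_s; apply: dim_le1.
have lsub u :
    u \in (lifted_gabidulin g g' c :&: bit_space (k + (k + r)) s)%VS ->
    u != 0 -> u = gabidulin_row g g' c (bits k p).
  rewrite memv_cap => /andP[/memv_lifted_gabidulin u_c].
  move=> /memv_bit_space[a sa ua] u0.
  rewrite u_c ua lsubmx_bits -bits_low; congr gabidulin_row.
  have /orP[/N.eqb_spec a0|/N.eqb_spec->//] := low_s a sa.
  case/eqP: u0; rewrite u_c ua lsubmx_bits -bits_low a0 bits0.
  exact: linear0.
by move=> u v Wu Wv /(lsub u Wu)-> /(lsub v Wv)->.
Qed.

(** * The 77 additional codewords *)

(** A row (p, v, e1, e2, e3) stands for the span of (p, v), (0, e1), (0, e2) and
    (0, e3) in F_2^4 x F_2^6, all components being binary codes.  The planes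
    <e1, e2, e3> come from a computer search for a set of 77 that is invariant
    under a linear map of order 3, and the pairs (p, v) from a local search that
    minimizes the number of pairs of codewords meeting in dimension 2 or more. *)
Definition extended_planes : seq (N * N * N * N * N) :=
  [:: (1,0,3,20,41); (1,1,7,24,33); (1,9,2,17,40); (1,13,3,28,32);
      (1,4,8,17,36); (1,1,11,21,37);
      (2,8,7,19,35); (2,11,7,17,41); (2,17,6,9,51); (2,3,10,16,36);
      (2,6,1,12,20); (2,32,2,12,16); (2,1,8,23,39);
      (3,0,1,2,44); (3,4,13,19,33); (3,16,4,8,33); (3,6,1,16,38); (3,8,3,4,25);
      (4,34,1,4,18); (4,5,9,16,33); (4,4,10,20,39); (4,2,13,16,32);
      (5,10,1,28,36); (5,2,11,18,38); (5,4,3,21,36); (5,5,3,8,16);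
      (5,0,12,19,34); (5,3,12,23,36);
      (6,2,12,22,38); (6,5,13,18,36); (6,1,4,24,40); (6,0,6,19,43);
      (6,4,2,24,37);
      (7,12,3,17,33); (7,0,4,11,50); (7,9,6,24,41); (7,0,3,13,37);
      (7,3,5,16,41);
      (8,8,5,26,40); (8,6,10,23,38); (8,1,2,4,32); (8,17,5,11,33);
      (8,0,13,22,34); (8,4,10,18,32);
      (9,10,7,27,42); (9,7,8,20,38); (9,1,4,10,17); (9,18,1,14,48);
      (9,4,10,22,33);
      (10,9,5,24,43); (10,49,2,5,8); (10,3,12,17,35); (10,4,14,20,34);
      (11,12,1,30,42); (11,2,8,21,34); (11,2,7,11,32); (11,10,1,26,32);
      (12,1,10,19,37); (12,8,5,25,34); (12,2,14,23,32); (12,3,4,16,43);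
      (12,8,7,18,40);
      (13,0,2,9,20); (13,35,6,11,17); (13,3,5,27,35); (13,12,2,21,33);
      (13,7,9,18,37);
      (14,9,7,16,34); (14,0,8,18,35); (14,4,3,12,52); (14,1,8,22,32);
      (14,1,14,19,39);
      (15,1,4,9,35); (15,20,1,10,34); (15,1,2,25,41); (15,0,14,22,35);
      (15,3,5,17,32)]%num.

(** The four lowest bits hold the component in F_2^4, and the next six bits the
    component in F_2^6. *)
Definition generators (c : N * N * N * N * N) : seq N :=
  let: (p, v, e1, e2, e3) := c in
  [seq N.add x.1 (N.shiftl x.2 4) |
     x <- [:: (p, v); (0, e1); (0, e2); (0, e3)]%num].

Definition codeword_ok (c : N * N * N * N * N) : bool :=
  xor_free 10 (generators c) &&
  all (fun a => N.eqb (low 4 a) 0 || N.eqb (low 4 a) c.1.1.1.1)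
      (words 10 (generators c)).

Lemma extended_planes_ok : all codeword_ok extended_planes.
Proof. by vm_compute. Qed.

Lemma extended_planes_meet :
  pairwise share_le1 (map (words 10 \o generators) extended_planes).
Proof. by vm_compute. Qed.

(** * The code of size 4173 *)

Lemma linear_coordinates (K : fieldType) (vT : vectType K) m :
    \dim {:vT} = m ->
  exists (g : {linear 'rV[K]_m -> vT}) (g' : {linear vT -> 'rV[K]_m}),
    cancel g g' /\ cancel g' g.
Proof.
case: m / => /=.
have basis_e := vbasisP {:vT}.
exists (vecof (vbasis {:vT})), (rVof (vbasis {:vT})).
by split; [apply: vecofK | apply: rVofK].
Qed.

Lemma F2_extension m :
  (0 < m)%N -> exists L : fieldExtType 'F_2, \dim {:L} = m.
Proof.
move=> m_gt0; have [F pcharF cardF] := pPrimePowerField (isT : prime 2) m_gt0.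
exists (pPrimeCharType pcharF).
by rewrite pprimeChar_dimf cardF pfactorK.
Qed.

Local Close Scope ring_scope.

Theorem theorem13 : 4173 <= A 'F_2 10 6 4.
Proof.
have [L /linear_coordinates[g [g' [gK g'K]]]] := @F2_extension (4 + 2) isT.
pose plane i := nth (0, 0, 0, 0, 0)%num extended_planes i.
pose U (i : 'rV['F_2]_(4 + 2) * 'rV['F_2]_(4 + 2) + 'I_77) :
    {vspace 'rV['F_2]_10} :=
  match i with
  | inl c => lifted_gabidulin g g' c
  | inr j => bit_space 10 (generators (plane j))
  end.
have plane_ok (j : 'I_77) : codeword_ok (plane j).
  by apply: (all_nthP _ extended_planes_ok); apply: ltn_ord.
have dimU i : \dim (U i) = 4.
  case: i => [c|j] /=; first exact: (@dim_lifted_gabidulin 4 2 L g g' c).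
  have /andP[/dim_bit_space-> _] := plane_ok j.
  by case: (plane j) => [[[[]]]].
have meet_planes (i j : 'I_77) :
    i < j -> (\dim (U (inr i) :&: U (inr j)) <= 1)%N.
  move=> lt_ij; apply: bit_space_meet.
  have/(pairwiseP [::]) meet := extended_planes_meet.
  have := meet i j (ltn_ord i) (ltn_ord j) lt_ij.
  by rewrite !(nth_map (0, 0, 0, 0, 0)%num) ?ltn_ord.
have meetU i j : i != j -> (\dim (U i :&: U j) <= 1)%N.
  case: i j => [c|i] [d|j] neq_ij.
  - exact: (@lifted_gabidulin_meet 4 2 L g g' gK g'K c d).
  - have /andP[_ /(@lifted_gabidulin_bit_space_meet 4 2)] := plane_ok j; exact.
  - rewrite capvC.
    have /andP[_ /(@lifted_gabidulin_bit_space_meet 4 2)] := plane_ok i; exact.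
  - have [lt_ij|lt_ji|/val_inj eq_ij] := ltngtP i j.
    + exact: meet_planes.
    + by rewrite capvC; apply: meet_planes.
    + by rewrite eq_ij eqxx in neq_ij.
have := @leq_A_of_family 'F_2 10 6 4 _ U isT dimU.
rewrite card_sum card_prod card_mx card_Fp // card_ord; apply=> i j /meetU meet.
(* The distance is 4 + 4 - 2 * dim, with dim at most 1. *)
rewrite /subspace_dist !dimU; apply: (@leq_sub2l 8 _ (2 * 1)).
by rewrite leq_mul2l.
Qed.
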